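(* Let $X$ be a locally compact Hausdorff topological space and let $k:X\times X\to[0,+\infty]$ be a nonnegative, lower semicontinuous, symmetric kernel function. Let $\emptyset\neq H\subset L\subset X$ be arbitrary and assume that there exists a measure $\mu\in\mathfrak{M}_1(H)$ which is $k$-invariant on $L$. Then $$A(H,L)=A(\mu,L).$$ Furthermore, if $k$ is continuous and $L$ is compact, then also $$R(H,L)=A(\mu,L).$$
   Context: $\mathfrak{M}_1(X)$ denotes the set of regular Borel probability measures on $X$. For $E\subset X$, $\mathfrak{M}_1(E)$ is the set of $\mu\in\mathfrak{M}_1(X)$ such that $E$ is $\mu$-measurable and $\mu(E)=\mu(X)=1$. The kernel $k$ is symmetric if $k(x,y)=k(y,x)$ for all $x,y\in X$; lower semicontinuity is meant as a function on $X\times X$. A continuous kernel is understood to be real-valued. The potential of $\mu\in\mathfrak{M}_1(X)$ is $U^{\mu}(x):=\int_X k(x,y)\,d\mu(y)\in[0,+\infty]$. A measure $\mu\in\mathfrak{M}_1(H)$ is called $k$-invariant on $L$ if $U^{\mu}$ is constant on $L$. For a set $S\subset[0,+\infty]$, $\overline{\mathrm{conv}}\,S$ denotes the closed convex hull in $[0,+\infty]$, i.e. the interval $[\inf S,\sup S]\subset[0,+\infty]$ (for nonempty $S$). For $\mu\in\mathfrak{M}_1(X)$ and $H,L\subset X$ put $$A(\mu,L):=\overline{\mathrm{conv}}\{U^{\mu}(x): x\in L\}=\Bigl[\inf_{x\in L}U^{\mu}(x),\ \sup_{x\in L}U^{\mu}(x)\Bigr],\qquad A(H,L):=\bigcap_{\mu\in\mathfrak{M}_1(H)}A(\mu,L)$$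 (the average set of $L$ with respect to $H$), and $$R_n(H,L):=\bigcap_{w_1,\dots,w_n\in H}\overline{\mathrm{conv}}\Bigl\{\frac1n\sum_{j=1}^n k(x,w_j): x\in L\Bigr\},\qquad R(H,L):=\bigcap_{n=1}^{\infty}R_n(H,L)$$ (the rendezvous set of $L$ with respect to $H$). *)

(* Defs.v *)
From HB Require Import structures.
From mathcomp Require Import all_boot all_order all_algebra.
From mathcomp Require Import all_classical all_reals all_analysis measurable_realfun.
Set Implicit Arguments.
Unset Strict Implicit.
Unset Printing Implicit Defensive.
Import Order.TTheory GRing.Theory Num.Theory.
Import numFieldNormedType.Exports.
Local Open Scope classical_set_scope.
Local Open Scope ring_scope.
Local Open Scope ereal_scope.

(* The library's measurable types are pointed, whence [ptopologicalType]. *)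
Definition borelType (X : ptopologicalType) := g_sigma_algebraType (@open X).

Section average_and_rendezvous_sets.
Context {R : realType} {X : ptopologicalType}.
Implicit Types (mu : probability (borelType X) R) (k : X * X -> \bar R).
Implicit Types (E H L : set X) (S : set (\bar R)).

(* Since mu is finite, compact inner regularity is required on all Borel sets. *)
Definition regular_borel mu : Prop :=
  forall B : set (borelType X), measurable B ->
    mu B = ereal_inf [set mu U | U in [set U : set X | open U /\ B `<=` U]] /\
    mu B = ereal_sup [set mu K | K in [set K : set X |
             compact K /\ measurable (K : set (borelType X)) /\ K `<=` B]].

(* E need not be Borel: it is measurable for the completion of mu, whose
   values are those of the outer measure mu^*. *)
Definition M1 E : set (probability (borelType X) R) :=
  [set mu | regular_borel mu /\
            completed_algebra_gen mu (E : set (borelType X)) /\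
            (mu^*)%mu (E : set (borelType X)) = 1].

Definition potential k mu (x : X) : \bar R :=
  \int[mu]_(y in [set: borelType X]) k (x, y).

Definition k_invariant k mu L : Prop :=
  exists c : \bar R, forall x, L x -> potential k mu x = c.

(* Closed convex hull, for nonempty S. *)
Definition cconv S : set (\bar R) :=
  [set` `[ereal_inf S, ereal_sup S]].

Definition average_set1 k mu L : set (\bar R) :=
  cconv [set potential k mu x | x in L].

Definition average_set k H L : set (\bar R) :=
  \bigcap_(mu in M1 H) average_set1 k mu L.

Definition rendezvous_setn k (n : nat) H L : set (\bar R) :=
  \bigcap_(w in [set w : 'I_n -> X | forall j, H (w j)])
    cconv [set (n%:R^-1)%:E * \sum_(j < n) k (x, w j) | x in L].

Definition rendezvous_set k H L : set (\bar R) :=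
  \bigcap_(n in [set n | (0 < n)%N]) rendezvous_setn k n H L.

End average_and_rendezvous_sets.

(* Main.v *)
Require Import Defs.
From HB Require Import structures.
From mathcomp Require Import all_boot all_order all_algebra.
From mathcomp Require Import all_classical all_reals all_analysis measurable_realfun.
Import Order.TTheory GRing.Theory Num.Theory.
Import numFieldNormedType.Exports.
Local Open Scope classical_set_scope.
Local Open Scope ring_scope.
Local Open Scope ereal_scope.

(** Let [c] be the value of [U^mu] on [L], so that [A(mu, L) = {c}], and recall
that a measure in [M1 H] gives mass one to some Borel subset of [H], hence of
[L] ([M1_carrier]).

For the average set, take [nu] in [M1 H]. Interchanging the integrals
([integral_potentialC]), the [mu]-mean of [U^nu] equals the [nu]-mean of [U^mu],
which is [c] because [nu] is carried by [L]; and the [mu]-mean of [U^nu] lies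
between the infimum and the supremum of [U^nu] over [L] because [mu] is carried
by [L] ([cconv_integral]). So [c] belongs to every [A(nu, L)].

The interchange is the delicate point: [k] is Borel on the product space, but
possibly not measurable for the product of the Borel sigma-algebras, so that
Tonelli's theorem does not apply to [k] itself. It does apply to the
product-measurable minorants of [k]; they form a family directed upwards, and
step functions on open rectangles show that it approaches [k] locally from
below. The passage to the limit is [integral_liminf], a Fatou lemma valid along
any filter for measures that are inner regular with respect to compact sets, as
soon as the lower bound on the integrands holds locally uniformly. The same
lemma gives the lower semicontinuity of potentials.

For the rendezvous set, [c] is the [mu]-mean of [x |-> 1/n sum_j k(x, w_j)] by
symmetry of [k], hence lies in every closed convex hull. Conversely, when [k] is
continuous and [L] compact there are points [w_j] of [H] whose mean potential is
within [e] of [c] uniformly on [L] ([uniform_averages]), so that no other value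
survives. By compactness it is enough to control finitely many points [y] of
[L]. There the [w_j] are chosen one after the other: the vectors
[(k(y, w) - c)_y] are bounded and have [mu]-mean zero, so the next one can be
taken (almost) not to point in the direction of the current sum, whose squared
length then grows only linearly in [n] ([small_sum_squares]). *)

Set Implicit Arguments.
Unset Strict Implicit.
Unset Printing Implicit Defensive.

Import HBNNSimple.

(** * Lower semicontinuity and a Fatou lemma along filters *)

Lemma lsc_measurable (R : realType) (X : ptopologicalType) (f : X -> \bar R) :
  lower_semicontinuous f ->
  measurable_fun [set: borelType X] (f : borelType X -> \bar R).
Proof.
move=> /lower_semicontinuousP lf.
apply: (measurability _ (ErealGenOInfty.measurableE R)).
move=> /= _ [_ [a ->]] <-; rewrite setTI preimage_itvoy.
apply: sub_sigma_algebra; exact: lf.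
Qed.

(** Superadditivity of the lower limit: the excess of the sum over [b] can be
shared between the head and the tail of the list. *)
Lemma near_lt_sum (R : realType) (I J : Type) (F : set_system I) {FF : Filter F}
    (s : seq J) (u : J -> R) (v : J -> I -> \bar R) :
  (forall j b, (b < u j)%R -> \forall i \near F, b%:E < v j i) ->
  forall b, (b < \sum_(j <- s) u j)%R ->
  \forall i \near F, b%:E <= \sum_(j <- s) v j i.
Proof.
move=> uv; elim: s => [|j s ih] b.
  by rewrite big_nil => b0; near=> i; rewrite big_nil lee_fin ltW.
rewrite big_cons => bus.
pose e := ((u j + \sum_(j <- s) u j - b) / 2)%R.
have e0 : (0 < e)%R by rewrite divr_gt0// subr_gt0.
have -> : b = ((u j - e) + (\sum_(j <- s) u j - e))%R.
  by rewrite addrACA -opprD -splitr opprB addrC subrK.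
have h1 := uv j (u j - e)%R ltac:(by rewrite ltrBlDr ltrDl).
have h2 := ih (\sum_(j <- s) u j - e)%R ltac:(by rewrite ltrBlDr ltrDl).
near=> i; rewrite big_cons EFinD leeD//; last by near: i.
by apply: ltW; near: i.
Unshelve. all: by end_near. Qed.

Lemma ge0_integral_ge_cst d (T : measurableType d) (R : realType)
    (m : {measure set T -> \bar R}) (A : set T) (r : R) (f : T -> \bar R) :
  measurable A -> measurable_fun A f -> (0 <= r)%R ->
  (forall x, A x -> r%:E <= f x) -> r%:E * m A <= \int[m]_(x in A) f x.
Proof.
move=> mA mf r0 rf; rewrite -integral_cst//; exact: ge0_le_integral.
Qed.

(** The sequential Fatou lemma fails for general filters. Here the bound
[a < f i x'] is required jointly for [x'] near [x] and [i] near [F]; compactness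
makes it uniform on compact sets, which exhaust the mass by regularity. *)
Section integral_liminf.
Context {R : realType} {X : ptopologicalType}.
Variable mu : probability (borelType X) R.
Hypothesis mu_reg : regular_borel mu.
Context {I : Type} (F : set_system I) {FF : Filter F}.
Variables (g : X -> \bar R) (f : I -> X -> \bar R).
Hypothesis g_ge0 : forall x, 0 <= g x.
Hypothesis f_meas : \forall i \near F,
  measurable_fun [set: borelType X] (f i : borelType X -> \bar R) /\
  forall x, 0 <= f i x.
Hypothesis gf : forall x (a : R), a%:E < g x ->
  \forall x' \near x & i \near F, a%:E < f i x'.

(** The case where [g] is bounded below by a constant on [A]: most of the mass
of [A] lies on a compact set, on which the strict bound eventually holds
everywhere. *)
Lemma integral_liminf_level (A : set (borelType X)) (r b : R) :
  measurable A -> (forall x, A x -> r%:E <= g x) ->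
  (b < r * fine (mu A))%R ->
  \forall i \near F, b%:E < \int[mu]_(x in A) f i x.
Proof.
move=> mA rg br.
have [b0|b0] := ltP b 0%R.
  near=> i; apply: (@lt_le_trans _ _ 0); first by rewrite lte_fin.
  by apply: integral_ge0 => x _; move: x; near: i; apply: filterS f_meas => i [].
have muA : mu A \is a fin_num by rewrite fin_num_measure.
have rmuA : (0 < r * fine (mu A))%R by exact: le_lt_trans br.
have muA0 : (0 <= fine (mu A))%R by rewrite fine_ge0.
have r0 : (0 < r)%R by rewrite ltNge; apply/negP => r0;
  move: rmuA; apply/negP; rewrite -leNgt mulr_le0_ge0.
have [_ muAK] := mu_reg mA.
have : (b / r)%:E < mu A.
  by rewrite -(fineK muA) lte_fin ltr_pdivrMr// mulrC.
rewrite {}muAK => /ereal_sup_gt[_ [K [cK [mK KA]]] <-] bK.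
have muK : mu K \is a fin_num by rewrite fin_num_measure.
move: bK; rewrite -(fineK muK) lte_fin ltr_pdivrMr// => bK.
have muK0 : (0 < fine (mu K))%R.
  rewrite lt_neqAle fine_ge0// andbT; apply/eqP => K0.
  by move: bK; rewrite -K0 mul0r ltNge b0.
(* Room is needed on both sides: [r' < r] makes the bound on [g] strict, while
   [r' * mu K] still exceeds [b]. *)
pose r' := ((b / fine (mu K) + r) / 2)%R.
have br' : (b / fine (mu K) < r)%R by rewrite ltr_pdivrMr// mulrC.
have r'r : (r' < r)%R by have := midf_lt br' => -[].
have b'r' : (b < r' * fine (mu K))%R.
  by rewrite -ltr_pdivrMr//; have := midf_lt br' => -[].
have r'0 : (0 <= r')%R.
  by apply: divr_ge0 => //; apply: addr_ge0; [apply: divr_ge0 => //; exact: ltW|exact: ltW].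
have KF : \forall i \near F, K `<=` [set x | r'%:E < f i x].
  apply: (iffLR (compact_near_coveringP K) cK I F (fun i x => r'%:E < f i x)) => x Kx.
  by apply: gf; apply: lt_le_trans (rg _ (KA _ Kx)); rewrite lte_fin.
near=> i.
have [mfi fi0] : measurable_fun [set: borelType X] (f i : borelType X -> \bar R) /\
  (forall x, 0 <= f i x) by near: i.
apply: (@lt_le_trans _ _ (\int[mu]_(x in K) f i x)); last first.
  by apply: ge0_subset_integral => //; exact: measurable_funTS.
apply: (@lt_le_trans _ _ (r'%:E * mu K)).
  by rewrite -(fineK muK) -EFinM lte_fin.
apply: ge0_integral_ge_cst => //; first exact: measurable_funTS.
move=> x Kx; apply: ltW; move: x Kx.
rewrite -/(K `<=` [set x | r'%:E < f i x]).
by near: i.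
Unshelve. all: by end_near. Qed.

(** The integral of [g] is a supremum of integrals of simple functions; apply
the previous lemma on each level set of one of them. *)
Lemma integral_liminf (a : R) :
  a%:E < \int[mu]_(x in [set: borelType X]) g x ->
  \forall i \near F, a%:E < \int[mu]_(x in [set: borelType X]) f i x.
Proof.
move=> ag.
have [h hg ah] : exists2 h : {nnsfun borelType X >-> R},
    (forall x, (h x)%:E <= g x) & a%:E < sintegral mu h.
  move: ag; rewrite ge0_integralTE// => /ereal_sup_gt[_ [h hg <-] ah].
  by exists h.
have fin_h : finite_set (range h) by exact: fimfunP.
pose s := finmap.enum_fset (fset_set (range h)).
pose A r : set (borelType X) := h @^-1` [set r].
have mA r : measurable (A r) by exact: measurable_sfunP.
have muA r : mu (A r) \is a fin_num by rewrite fin_num_measure.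
pose b := (\sum_(r <- s) r * fine (mu (A r)))%R.
have hb : sintegral mu h = b%:E.
  rewrite sintegralE fsbig_finite//= /b -sumEFin; apply: eq_bigr => r _.
  by rewrite EFinM fineK.
have ab : (a < b)%R by rewrite -lte_fin -hb.
have amid := midf_lt ab.
have : \forall i \near F, ((a + b) / 2)%:E <= \sum_(r <- s) \int[mu]_(x in A r) f i x.
  apply: (@near_lt_sum _ _ _ F _ s (fun r => (r * fine (mu (A r)))%R)
    (fun r i => \int[mu]_(x in A r) f i x)); last exact: amid.2.
  by move=> r c; apply: integral_liminf_level => // x <-.
move=> Hs; near=> i.
have [mfi fi0] : measurable_fun [set: borelType X] (f i : borelType X -> \bar R) /\
  (forall x, 0 <= f i x) by near: i.
apply: (@lt_le_trans _ _ ((a + b) / 2)%:E); first by rewrite lte_fin amid.1.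
apply: (@le_trans _ _ (\sum_(r <- s) \int[mu]_(x in A r) f i x)); first by near: i.
rewrite -ge0_integral_bigsetU//=.
- apply: ge0_subset_integral => //.
  exact: bigsetU_measurable.
- exact: finmap.fset_uniq.
- by move=> r1 r2 _ _ [x [/= <- <-]].
- exact: measurable_funTS.
Unshelve. all: by end_near. Qed.

End integral_liminf.

(** * Interchange of integrals for a lower semicontinuous kernel *)

Section lsc_kernel.
Context {R : realType} {X : ptopologicalType}.
Variable k : X * X -> \bar R.
Hypothesis k_ge0 : forall p, 0 <= k p.
Hypothesis k_lsc : lower_semicontinuous k.
Hypothesis k_sym : forall x y, k (x, y) = k (y, x).

Lemma lsc_rect (x y : X) (a : R) : a%:E < k (x, y) ->
  exists U V : set X, [/\ nbhs x U, nbhs y V &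
    forall x' y', U x' -> V y' -> a%:E < k (x', y')].
Proof.
move=> /k_lsc[W [[U V] [/= xU yV] UVW] Wk].
by exists U, V; split => // x' y' Ux Vy; apply/Wk/UVW.
Qed.

Lemma lsc_kernel_section x : lower_semicontinuous (fun y => k (x, y)).
Proof.
move=> y a /lsc_rect[U [V [xU yV UV]]]; exists V => // z Vz.
by apply: UV => //; exact: nbhs_singleton.
Qed.

Lemma measurable_kernel_section x :
  measurable_fun [set: borelType X] (fun y : borelType X => k (x, y)).
Proof. apply: lsc_measurable; exact: lsc_kernel_section. Qed.

(** The Fatou lemma along the neighbourhoods of [x]. *)
Lemma lsc_potential (mu : probability (borelType X) R) :
  regular_borel mu -> lower_semicontinuous (potential k mu).
Proof.
move=> mu_reg x a.
move=> /(@integral_liminf R X mu mu_reg X (nbhs x) _ (fun y => k (x, y))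
  (fun z y => k (z, y))) H.
exists (fun z => a%:E < potential k mu z) => //; apply: H => //.
  by apply: nearW => z; split => //; exact: measurable_kernel_section.
move=> y b /lsc_rect[U [V [xU yV UV]]].
by exists (V, U) => //= -[y' x'] /= [Vy Ux]; exact: UV.
Qed.

Lemma measurable_potential (mu : probability (borelType X) R) :
  regular_borel mu ->
  measurable_fun [set: borelType X] (potential k mu : borelType X -> \bar R).
Proof. by move=> mu_reg; apply: lsc_measurable; exact: lsc_potential. Qed.

Definition minorant (f : X * X -> \bar R) :=
  [/\ measurable_fun [set: (borelType X * borelType X)%type]
        (f : borelType X * borelType X -> \bar R),
      forall p, 0 <= f p & forall p, f p <= k p].

(** The tail filter of the minorants ordered pointwise: limits along it are
suprema of increasing nets. *)
Definition large_minorants : set_system (X * X -> \bar R) :=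
  filter_from minorant
    (fun f => [set h | minorant h /\ forall p, f p <= h p]).

Lemma minorant_max f h : minorant f -> minorant h ->
  minorant (fun p => maxe (f p) (h p)).
Proof.
move=> [mf f0 fk] [mh h0 hk]; split; first exact: measurable_maxe.
- by move=> p; rewrite le_max f0.
- by move=> p; rewrite ge_max fk hk.
Qed.

#[local] Instance large_minorants_filter : Filter large_minorants.
Proof.
apply: filter_from_filter; first by exists (cst 0); split => // p.
move=> f h mf mh; exists (fun p => maxe (f p) (h p)); first exact: minorant_max.
by move=> u [mu hu]; split; split => // p; apply: le_trans (hu p);
  rewrite le_max lexx ?orbT.
Qed.

Lemma near_minorant : \forall f \near large_minorants, minorant f.
Proof. by exists (cst 0) => [|f []//]; split => // p. Qed.

(** [k] is locally a supremum of product-measurable functions: by lower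
semicontinuity, [k > b] on an open rectangle, and [b] times the indicator of
that rectangle is a minorant. *)
Lemma large_minorants_rect (x y : X) (a : R) : a%:E < k (x, y) ->
  exists U V : set X, [/\ nbhs x U, nbhs y V &
    \forall f \near large_minorants,
      forall x' y', U x' -> V y' -> a%:E < f (x', y')].
Proof.
move=> ak; have [a0|a0] := ltP a 0%R.
  exists setT, setT; split; [exact: filterT|exact: filterT|].
  by near=> f => x' y' _ _; apply: (@lt_le_trans _ _ 0);
    [rewrite lte_fin|have [] : minorant f by near: f; exact: near_minorant].
have [b ab bk] : exists2 b : R, (a < b)%R & b%:E < k (x, y).
  move: ak; case: (k (x, y)) => [c|_|//].
    by rewrite lte_fin => ac; exists ((a + c) / 2)%R; rewrite ?lte_fin midf_lt.
  by exists (a + 1)%R; rewrite ?ltrDl// ltry.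
have [U [V [xU yV UV]]] := lsc_rect bk.
exists U°, V°; split; [exact: nbhs_interior|exact: nbhs_interior|].
have b0 : (0 <= b)%R by rewrite (le_trans a0)// ltW.
pose E : set (borelType X * borelType X) := U° `*` V°.
exists (fun p => (b * \1_E p)%:E).
  split.
  - apply/measurable_EFinP/measurable_funM => //; apply: measurable_indic.
    by apply: measurableX; apply: sub_sigma_algebra; exact: open_interior.
  - by move=> p; rewrite lee_fin mulr_ge0.
  - move=> [x' y']; rewrite indicE; have [|_] := boolP (_ \in E); last by rewrite mulr0.
    rewrite inE mulr1 => -[/= /interior_subset Ux /interior_subset Vy].
    by apply: ltW; apply: UV.
move=> f [_ Ef] x' y' Ux Vy; apply: lt_le_trans (Ef _).
by rewrite indicE mem_set//= mulr1 lte_fin.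
Unshelve. all: by end_near. Qed.

(** Two applications of the Fatou lemma, one for each integral, give a minorant
[f] with [a < \int\int f]; Tonelli's theorem holds for [f], and [f <= k]. The
inner application uses the filter of pairs (point, minorant), which provides the
local uniformity required by the outer one. *)
Lemma integral_potential_le (mu nu : probability (borelType X) R) :
  regular_borel mu -> regular_borel nu ->
  \int[nu]_(x in [set: borelType X]) potential k mu x
  <= \int[mu]_(y in [set: borelType X]) potential k nu y.
Proof.
move=> mu_reg nu_reg.
pose G (f : X * X -> \bar R) x := \int[mu]_(y in [set: borelType X]) f (x, y).
have GF x (a : R) : a%:E < G k x ->
    \forall x' \near x & f \near large_minorants, a%:E < G f x'.
  move=> /(@integral_liminf R X mu mu_reg _
      (filter_prod (nbhs x) large_minorants) _
      (fun y => k (x, y)) (fun i y => i.2 (i.1, y))); apply => //.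
    exists (setT, minorant); first by split => /=; [exact: filterT|exact: near_minorant].
    move=> [x' f] /= [_ [mf f0 _]]; split => //.
    exact: (measurable_fun_pair2 (T1 := borelType X) (T2 := borelType X) x').
  move=> y b /large_minorants_rect[U [V [xU yV UVF]]].
  exists (V, [set i | U i.1 /\ forall x' y', U x' -> V y' -> b%:E < i.2 (x', y')]).
    split => //=.
    exists (U, [set f | forall x' y', U x' -> V y' -> b%:E < f (x', y')]) => //.
  by move=> [y' [x' f]] /= [Vy [Ux]]; exact.
have H (a : R) : a%:E < \int[nu]_(x in [set: borelType X]) G k x ->
    \forall f \near large_minorants,
      a%:E < \int[nu]_(x in [set: borelType X]) G f x.
  apply: integral_liminf => //.
    by move=> x; exact: integral_ge0.
  apply: filterS near_minorant => f [mf f0 _]; split.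
    exact: (measurable_fun_fubini_tonelli_F (m2 := mu)).
  by move=> x; exact: integral_ge0.
rewrite leNgt; apply/negP => lt_kk.
have ge0 : 0 <= \int[mu]_(y in [set: borelType X]) potential k nu y.
  by apply: integral_ge0 => y _; exact: integral_ge0.
case E : (\int[mu]_(y in _) _) ge0 lt_kk => [r| |]//= _ lt_rk;
  last by move: lt_rk; rewrite ltNge leey.
(* The minorant from which the eventual bound starts satisfies it. *)
have [f mf] := H r lt_rk.
move=> /(_ f (conj mf (fun=> lexx _)))/=; apply/negP; rewrite -leNgt -E.
have [mf' f0 fk] := mf.
rewrite /G (fubini_tonelli (m1 := nu) (m2 := mu))//.
apply: ge0_le_integral => //.
- by move=> y _; exact: integral_ge0.
- exact: (measurable_fun_fubini_tonelli_G (m1 := nu)).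
- exact: measurable_potential.
- move=> y _; apply: ge0_le_integral => //.
  + exact: (measurable_fun_pair1 (T1 := borelType X) (T2 := borelType X) y).
  + exact: measurable_kernel_section.
  + by move=> x _; rewrite k_sym.
Qed.

Lemma integral_potentialC (mu nu : probability (borelType X) R) :
  regular_borel mu -> regular_borel nu ->
  \int[nu]_(x in [set: borelType X]) potential k mu x
  = \int[mu]_(y in [set: borelType X]) potential k nu y.
Proof.
by move=> rmu rnu; apply/eqP; rewrite eq_le !integral_potential_le.
Qed.

End lsc_kernel.

(** * Measures carried by a set *)

Section carried_integrals.
Context {R : realType} {X : ptopologicalType}.
Implicit Types (mu nu : probability (borelType X) R) (L H : set X).

(** A set measurable for the completion is Borel up to a null set, and the
null part does not contribute to the outer measure. *)
Lemma M1_carrier H mu : M1 H mu ->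
  exists B : set (borelType X), [/\ measurable B, B `<=` H & mu B = 1].
Proof.
move=> [_ [[A /= mA [N [C [mC C0 NC]]] <-{H}]]] muAN.
exists A; split => //.
apply/eqP; rewrite eq_le probability_le1//=.
rewrite -[leLHS]muAN.
apply: (@le_trans _ _ ((mu^*)%mu (A `|` C))).
  by apply: le_mu_ext; exact: setUS.
rewrite measurable_mu_extE; last exact: measurableU.
apply: (le_trans (measureU2 _ _ _)) => //.
by rewrite [X in _ + X]C0 adde0.
Qed.

Variables (mu : probability (borelType X) R) (B : set (borelType X)).
Hypotheses (mB : measurable B) (muB : mu B = 1).

Lemma integral_carrier (f : X -> \bar R) :
  measurable_fun [set: borelType X] (f : borelType X -> \bar R) ->
  (forall x, 0 <= f x) ->
  \int[mu]_(x in [set: borelType X]) f x = \int[mu]_(x in B) f x.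
Proof.
move=> mf f0; rewrite (@ge0_negligible_integral _ _ _ mu setT (~` B))//.
- by rewrite setDE setCK setTI.
- exact: measurableC.
- by have := probability_setC mu mB; rewrite muB subee// => <-.
Qed.

Lemma cconv_integral L (f : X -> \bar R) :
  measurable_fun [set: borelType X] (f : borelType X -> \bar R) ->
  (forall x, 0 <= f x) -> B `<=` L ->
  cconv [set f x | x in L] (\int[mu]_(x in [set: borelType X]) f x).
Proof.
move=> mf f0 BL; rewrite integral_carrier// /cconv /= in_itv /=.
have mfB : measurable_fun B (f : borelType X -> \bar R) by exact: measurable_funTS.
apply/andP; split.
  rewrite -[leLHS]mule1 -muB -integral_cst//.
  apply: ge0_le_integral => //.
    by move=> x _; apply: le_ereal_inf_tmp => _ [y _ <-].
  by move=> x Bx; apply: ereal_inf_lbound; exists x => //; exact: BL.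
rewrite -[leRHS]mule1 -muB -integral_cst//.
apply: ge0_le_integral => //.
by move=> x Bx; apply: ereal_sup_ubound; exists x => //; exact: BL.
Qed.

Lemma integral_carrier_cst L (f : X -> \bar R) c :
  measurable_fun [set: borelType X] (f : borelType X -> \bar R) ->
  (forall x, 0 <= f x) -> B `<=` L -> (forall x, L x -> f x = c) ->
  \int[mu]_(x in [set: borelType X]) f x = c.
Proof.
move=> mf f0 BL fc; rewrite integral_carrier//.
rewrite (eq_integral (cst c)); last by move=> x /[!inE] /BL/fc.
by rewrite integral_cst//= [X in _ * X]muB mule1.
Qed.

End carried_integrals.

Lemma cconv_cst (R : realType) (T : Type) (L : set T) (f : T -> \bar R) c :
  L !=set0 -> (forall x, L x -> f x = c) ->
  cconv [set f x | x in L] = [set c].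
Proof.
move=> [x0 Lx0] fc; rewrite /cconv.
have -> : [set f x | x in L] = [set c].
  by apply/seteqP; split=> [_ [x Lx <-]|_ ->]; [exact: fc|exists x0 => //; exact: fc].
rewrite ereal_inf1 ereal_sup1; apply/seteqP; split => [t|t ->] /=.
  by rewrite in_itv /= => ?; apply/eqP; rewrite eq_le andbC.
by rewrite in_itv /= lexx.
Qed.

(** The potential of [nu] has [mu]-mean [c], hence [c] is between its extreme
values on [L]. *)
Lemma average_set_invariant (R : realType) (X : ptopologicalType)
    (k : X * X -> \bar R) (H L : set X) (mu : probability (borelType X) R) :
  (forall p, 0 <= k p) -> lower_semicontinuous k ->
  (forall x y, k (x, y) = k (y, x)) ->
  L !=set0 -> H `<=` L -> M1 H mu -> k_invariant k mu L ->
  average_set k H L = average_set1 k mu L.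
Proof.
move=> k0 k_lsc k_sym L0 HL muH [c Uc]; apply/seteqP; split.
  by move=> t; exact.
rewrite /average_set1 (cconv_cst L0 Uc) => _ -> nu nuH.
have [A [mA AH muA]] := M1_carrier muH.
have [B [mB BH nuB]] := M1_carrier nuH.
have [mu_reg _] := muH; have [nu_reg _] := nuH.
have U0 (m : probability (borelType X) R) x : 0 <= potential k m x.
  exact: integral_ge0.
rewrite -(@integral_carrier_cst _ _ nu B mB nuB L (potential k mu) c)//.
- rewrite integral_potentialC//; apply: (@cconv_integral _ _ mu A) => //.
    exact: measurable_potential.
  exact: subset_trans HL.
- exact: measurable_potential.
- exact: subset_trans HL.
Qed.

(** * Discrete measures with almost constant potential *)

(** A derandomized law of large numbers. Expanding
[|S_n + v(z)|^2 = |S_n|^2 + 2 <S_n, v(z)> + |v(z)|^2], the increment is at most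
[2 + sum_j C] when [z] satisfies [<S_n, v(z)> <= 1]. *)
Lemma small_sum_squares (R : realFieldType) (J T : Type) (xs : seq J)
    (v : J -> T -> R) (B : set T) (C : R) :
  (forall j w, B w -> (v j w ^+ 2 <= C)%R) ->
  (forall S : J -> R, exists2 w, B w & (\sum_(j <- xs) S j * v j w <= 1)%R) ->
  forall n, exists2 w : nat -> T, (forall i, B (w i)) &
    (\sum_(j <- xs) (\sum_(i < n) v j (w i)) ^+ 2
     <= n%:R * (2 + \sum_(j <- xs) C))%R.
Proof.
move=> vC Bv; elim=> [|n [w Bw ih]].
  have [w Bw _] := Bv (fun=> 0%R).
  exists (fun=> w) => //; rewrite mul0r big1// => j _.
  by rewrite big_ord0 expr0n.
have [z Bz Sz] := Bv (fun j => \sum_(i < n) v j (w i))%R.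
exists (fun i => if (i < n)%N then w i else z); first by move=> i; case: ifP.
under eq_bigr => j _.
  rewrite big_ord_recr /= ltnn.
  under eq_bigr => i _ do rewrite ltn_ord.
  rewrite sqrrD -addrA; over.
rewrite !big_split/= -natr1 mulrDl mul1r lerD// lerD//.
  by rewrite -[leRHS]/(1 + 1)%R lerD.
by apply: ler_sum => j _; exact: vC.
Qed.

(** The bound [1] rather than [0] keeps the argument elementary: otherwise one
would need that a positive function has a positive integral. *)
Lemma exists_le1_integral0 d (T : measurableType d) (R : realType)
    (m : {finite_measure set T -> \bar R}) (B : set T) (f : T -> R) :
  measurable B -> m B = 1 -> m.-integrable B (EFin \o f) ->
  \int[m]_(x in B) (f x)%:E = 0 -> exists2 w, B w & (f w <= 1)%R.
Proof.
move=> mB mB1 intf f0; apply: contrapT => H.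
have : \int[m]_(x in B) cst 1 x <= \int[m]_(x in B) (f x)%:E.
  apply: le_integral => //.
    exact: (finite_measure_integrable_cst m 1 mB).
  move=> x; rewrite inE => Bx; rewrite lee_fin leNgt; apply/negP => fx.
  by apply: H; exists x => //; exact: ltW.
by rewrite f0 integral_cst// mul1e [leLHS]mB1 lee_fin ler10.
Qed.

Section compact_continuous_kernel.
Context {R : realType} {X : ptopologicalType}.
Variables (h : X * X -> R) (L : set X).
Hypotheses (h_cont : continuous h) (cL : compact L).

(** Total boundedness of the sections of [h] in the uniform norm on [L]: near a
point [y], continuity at the points [(y, w)] is uniform in [w] because [w]
ranges over a compact set, and finitely many such neighbourhoods cover [L]. *)
Lemma kernel_sections_net (e : R) : (0 < e)%R ->
  exists2 xs : seq X, (forall y, y \in xs -> L y) &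
    forall x, L x -> exists2 y, y \in xs &
      forall w, L w -> (`|h (x, w) - h (y, w)| < e)%R.
Proof.
move=> e0.
pose U y := [set x | forall w, L w -> (`|h (x, w) - h (y, w)| < e)%R]°.
have := cL; rewrite compact_cover => /(_ X L U) [].
- by move=> y _; exact: open_interior.
- move=> y Ly; exists y => //; rewrite /U /interior /=.
  apply: (iffLR (compact_near_coveringP L) cL X (nbhs y)
    (fun x w => (`|h (x, w) - h (y, w)| < e)%R)) => w Lw.
  have e2 : (0 < e / 2)%R by rewrite divr_gt0.
  have /cvgrPdist_lt/(_ _ e2)[[P Q]/= [yP wQ] PQ] :
    h @ nbhs (y, w) --> h (y, w) by exact: h_cont.
  exists (Q, P) => // -[w' x] /= [Qw Px].
  have h1 := PQ (x, w') (conj Px Qw).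
  have h2 := PQ (y, w') (conj (nbhs_singleton yP) Qw).
  rewrite (splitr e) -[X in (`|X| < _)%R](subrKA (h (y, w))).
  by rewrite (le_lt_trans (ler_normD _ _))// ltrD// distrC.
- move=> D DL LU; exists (finmap.enum_fset D).
    by move=> y /DL; rewrite inE.
  by move=> x /LU[y /= yD /interior_subset]; exists y.
Qed.

Lemma kernel_bounded : exists C : R, forall x y, L x -> L y -> (`|h (x, y)| <= C)%R.
Proof.
have : compact (h @` (L `*` L)).
  by apply: continuous_compact; [exact: continuous_subspaceT|exact: compact_setX].
move=> /compact_bounded[M [_ HM]]; exists (M + 1)%R => x y Lx Ly.
by apply: (HM (M + 1)%R); [rewrite ltrDl|exists (x, y)].
Qed.

Variables (mu : probability (borelType X) R) (B : set (borelType X)) (c : R).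
Hypotheses (mB : measurable B) (muB : mu B = 1) (BL : B `<=` L).
Hypothesis h_meas : forall x,
  measurable_fun [set: borelType X] (fun y : borelType X => h (x, y)).

Lemma kernel_section_integrable x : L x ->
  mu.-integrable B (fun y => (h (x, y))%:E).
Proof.
move=> Lx; have [C hC] := kernel_bounded.
apply: (@measurable_bounded_integrable _ (borelType X) R mu
  (fun y => h (x, y)) B) => //.
- by rewrite [ltLHS]muB ltry.
- exact: measurable_funTS.
- exists C; split; first exact: num_real.
  by move=> M CM y By /=; apply: le_trans (ltW CM); apply: hC => //; exact: BL.
Qed.

Hypothesis h_inv : forall x, L x -> \int[mu]_(y in B) (h (x, y))%:E = c%:E.

(** On an [e / 2]-net of [L] the means are close to [c] by
[small_sum_squares]; the net property extends this to [L]. *)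
Lemma uniform_averages (e : R) : (0 < e)%R ->
  exists n, exists2 w : 'I_n -> X, (0 < n)%N /\ (forall j, B (w j)) &
    forall x, L x -> (`|n%:R^-1 * \sum_(j < n) h (x, w j) - c| <= e)%R.
Proof.
move=> e0; have e2 : (0 < e / 2)%R by rewrite divr_gt0.
have [xs xsL net] := kernel_sections_net e2.
have [C hC] := kernel_bounded.
(* Setting [v] to zero outside the net makes the bound and the zero mean hold for all [y]. *)
pose v y w := (if y \in xs then h (y, w) - c else 0)%R.
have vC y w : B w -> (v y w ^+ 2 <= (C + `|c|) ^+ 2)%R.
  move=> Bw; rewrite /v; case: ifPn => [yxs|_]; last by rewrite expr0n sqr_ge0.
  rewrite -real_normK ?num_real// lerXn2r// ?nnegrE//.
    by rewrite addr_ge0// (le_trans _ (hC _ _ (BL Bw) (BL Bw))).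
  by rewrite (le_trans (ler_normB _ _))// lerD2r hC//; [exact: xsL|exact: BL].
have intv y : mu.-integrable B (EFin \o v y) /\ \int[mu]_(w in B) (v y w)%:E = 0.
  rewrite /v; case: (boolP (y \in xs)) => [/xsL Ly|_]; last first.
    by split; [exact: integrable0|rewrite integral0].
  have ih := kernel_section_integrable Ly.
  have ic : mu.-integrable B (cst c%:E).
    exact: (finite_measure_integrable_cst mu c mB).
  split; first by rewrite /comp; under eq_fun do rewrite EFinB; exact: integrableB.
  under eq_integral do rewrite EFinB.
  rewrite integralB//.
  by rewrite h_inv// integral_cst//= [X in _ * X]muB mule1 subee.
have intSv (S : X -> R) y : mu.-integrable B (fun w => (S y * v y w)%:E).
  under eq_fun do rewrite EFinM.
  by apply: integrableZl => //; exact: (intv y).1.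
have Bv (S : X -> R) : exists2 w, B w & (\sum_(y <- xs) S y * v y w <= 1)%R.
  apply: (exists_le1_integral0 mB muB).
    rewrite /comp; under eq_fun do rewrite -sumEFin.
    exact: integrable_sum.
  under eq_integral do rewrite -sumEFin.
  rewrite integral_sum//; apply: big1 => y _.
  under eq_integral do rewrite EFinM.
  by rewrite integralZl//; [rewrite (intv y).2 mule0|exact: (intv y).1].
pose K := (2 + \sum_(y <- xs) (C + `|c|) ^+ 2)%R.
have K0 : (0 <= K)%R by rewrite addr_ge0// sumr_ge0// => y _; exact: sqr_ge0.
(* [n] is large enough for [n * K] to be at most [(n * (e / 2)) ^ 2]. *)
pose n := (Num.trunc (K / (e / 2) ^+ 2)).+1.
have n0 : (0 < n%:R :> R)%R by rewrite ltr0n.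
have Kn : (K <= n%:R * (e / 2) ^+ 2)%R.
  by rewrite -ler_pdivrMr ?exprn_gt0// ltW// truncnS_gt.
have [w Bw Sw] := small_sum_squares vC Bv n.
exists n, (fun j : 'I_n => w j); first by split.
move=> x Lx; have [y yxs xy] := net _ Lx.
have Sy : (`|n%:R^-1 * \sum_(j < n) v y (w j)| <= e / 2)%R.
  rewrite -ler_sqr ?nnegrE//; last exact: ltW.
  rewrite real_normK ?num_real// exprMn exprVn ler_pdivrMl ?exprn_gt0//.
  apply: (@le_trans _ _ (n%:R * K)%R); last by rewrite expr2 -mulrA ler_pM2l.
  apply: le_trans Sw.
  rewrite (big_rem y)//= lerDl sumr_ge0// => z _; exact: sqr_ge0.
have -> : (n%:R^-1 * \sum_(j < n) h (x, w j) - c =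
    n%:R^-1 * \sum_(j < n) (h (x, w j) - h (y, w j))
    + n%:R^-1 * \sum_(j < n) v y (w j))%R.
  rewrite -mulrDr -big_split/=.
  under [in RHS]eq_bigr do rewrite /v yxs subrKA.
  by rewrite sumrB mulrBr sumr_const card_ord -[(c *+ n)%R]mulr_natl mulKf ?gt_eqF.
rewrite (splitr e) (le_trans (ler_normD _ _))// lerD//.
rewrite normrM ger0_norm ?invr_ge0// ler_pdivrMl//.
apply: (le_trans (ler_norm_sum _ _ _)).
apply: (@le_trans _ _ (\sum_(j < n) (e / 2))%R).
  by apply: ler_sum => j _; apply: ltW; apply: xy; exact: BL.
by rewrite big_const_ord iter_addr_0 mulr_natl.
Qed.
End compact_continuous_kernel.

(** * Averages over points and the rendezvous set *)

Lemma integral_mean_potentials (R : realType) (X : ptopologicalType)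
    (k : X * X -> \bar R) (mu : probability (borelType X) R) (n : nat)
    (w : 'I_n -> X) :
  (forall p, 0 <= k p) -> lower_semicontinuous k ->
  (forall x y, k (x, y) = k (y, x)) ->
  let f x := (n%:R^-1)%:E * \sum_(j < n) k (x, w j) in
  measurable_fun [set: borelType X] (f : borelType X -> \bar R) /\
  \int[mu]_(x in [set: borelType X]) f x =
  (n%:R^-1)%:E * \sum_(j < n) potential k mu (w j).
Proof.
move=> k0 k_lsc k_sym f.
have mk j : measurable_fun [set: borelType X] (fun x : borelType X => k (x, w j)).
  by under eq_fun do rewrite k_sym; exact: measurable_kernel_section.
have ms : measurable_fun [set: borelType X]
    (fun x : borelType X => \sum_(j < n) k (x, w j)) by exact: emeasurable_sum.
split; first exact: emeasurable_funM.
rewrite ge0_integralZl//.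
  rewrite ge0_integral_sum//; congr (_ * _); apply: eq_bigr => j _.
  by apply: eq_integral => x _; exact: k_sym.
by move=> x _; exact: sume_ge0.
Qed.

(** A member [t] of the rendezvous set lies within every [e] of [c], by
comparison with a nearly constant mean potential; conversely [c] is the
[mu]-mean of each mean potential. *)
Lemma rendezvous_set_invariant (R : realType) (X : ptopologicalType)
    (k : X * X -> \bar R) (H L : set X) (mu : probability (borelType X) R) :
  (forall p, 0 <= k p) -> lower_semicontinuous k ->
  (forall x y, k (x, y) = k (y, x)) ->
  (forall p, k p \is a fin_num) -> continuous k -> compact L ->
  L !=set0 -> H `<=` L -> M1 H mu -> k_invariant k mu L ->
  rendezvous_set k H L = average_set1 k mu L.
Proof.
move=> k0 k_lsc k_sym k_fin k_cont cL L0 HL muH [c Uc].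
rewrite /average_set1 (cconv_cst L0 Uc).
have [B [mB BH muB]] := M1_carrier muH.
have BL : B `<=` L by exact: subset_trans HL.
pose h p := fine (k p).
have hE p : (h p)%:E = k p by rewrite fineK.
have h_cont : continuous h.
  by move=> p; apply: fine_cvg; rewrite fineK//; exact: k_cont.
have h_meas x : measurable_fun [set: borelType X] (fun y : borelType X => h (x, y)).
  apply/measurable_EFinP; rewrite /comp; under eq_fun do rewrite hE.
  exact: measurable_kernel_section.
have hc x : L x -> \int[mu]_(y in B) (h (x, y))%:E = c.
  move=> Lx; rewrite -(Uc _ Lx) /potential (integral_carrier mB muB)//.
    by apply: eq_integral => y _; exact: hE.
  exact: measurable_kernel_section.
have c_fin : c \is a fin_num.
  have [x Lx] := L0; rewrite -(hc _ Lx); apply: integrable_fin_num => //.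
  exact: (kernel_section_integrable h_cont cL mB muB BL h_meas).
have meanE n (w : 'I_n -> X) x : (n%:R^-1)%:E * \sum_(j < n) k (x, w j) =
    (n%:R^-1 * \sum_(j < n) h (x, w j))%:E.
  by rewrite EFinM -sumEFin; congr (_ * _); apply: eq_bigr => j _; rewrite hE.
apply/seteqP; split => [t Rt|_ -> n /= n0 w Hw].
- have tc e : (0 < e)%R -> c - e%:E <= t <= c + e%:E.
    move=> e0; have [|n [w [n0 Bw] we]] :=
        @uniform_averages _ _ h L h_cont cL mu B (fine c) mB muB BL h_meas _ e e0.
      by move=> x Lx; rewrite fineK//; exact: hc.
    have := Rt n n0 w (fun j => BH _ (Bw j)).
    rewrite /cconv /= in_itv /= => /andP[it ts]; rewrite -(fineK c_fin); apply/andP; split.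
      apply: le_trans it; apply: le_ereal_inf_tmp => _ [x Lx <-].
      rewrite meanE -EFinB lee_fin.
      by have := we _ Lx; rewrite ler_distl => /andP[].
    apply: (le_trans ts); apply: ge_ereal_sup => _ [x Lx <-].
    rewrite meanE -EFinD lee_fin.
    by have := we _ Lx; rewrite ler_distl => /andP[].
  apply/eqP; rewrite eq_le; apply/andP; split.
    by apply/lee_addgt0Pr => e /tc/andP[].
  by apply/lee_subgt0Pr => e /tc/andP[].
- have [mf intf] := integral_mean_potentials mu w k0 k_lsc k_sym.
  have <- : \int[mu]_(x in [set: borelType X])
      ((n%:R^-1)%:E * \sum_(j < n) k (x, w j)) = c.
    have Uw j : potential k mu (w j) = (fine c)%:E.
      by rewrite fineK //; apply: Uc; exact: HL.
    rewrite intf -[RHS](fineK c_fin).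
    under eq_bigr => j _ do rewrite Uw.
    rewrite sumEFin -EFinM sumr_const card_ord -[(fine c *+ n)%R]mulr_natl.
    by rewrite mulKf// pnatr_eq0 -lt0n.
  apply: (cconv_integral mB muB mf _ BL) => x.
  by apply: mule_ge0; [rewrite lee_fin invr_ge0|exact: sume_ge0].
Qed.

Unset Implicit Arguments.
Set Strict Implicit.
Set Printing Implicit Defensive.

Theorem theorem4p1 (R : realType) (X : ptopologicalType)
    (Xlc : locally_compact [set: X]) (Xhausdorff : hausdorff_space X)
    (k : X * X -> \bar R)
    (k_ge0 : forall p, 0 <= k p)
    (k_lsc : lower_semicontinuous k)
    (k_sym : forall x y, k (x, y) = k (y, x))
    (H L : set X) (H0 : H !=set0) (HL : H `<=` L)
    (mu : probability (borelType X) R) (muH : M1 H mu)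
    (mu_inv : k_invariant k mu L) :
  average_set k H L = average_set1 k mu L /\
  ((forall p, k p \is a fin_num) -> continuous k -> compact L ->
   rendezvous_set k H L = average_set1 k mu L).
Proof.
have L0 : L !=set0 by have [x Hx] := H0; exists x; exact: HL.
split; first exact: average_set_invariant.
by move=> k_fin k_cont cL; exact: rendezvous_set_invariant.
Qed.
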